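(* Let $k$ be a field, let $G$ be an additive ordered abelian group and let $\mathcal{F}$ be a family of well-ordered subsets of $G$. Suppose that at least one of the following holds: (i) $\mathrm{char}(k)=0$; (ii) $|k|\geq \sup\{|A| \mid A \text{ is a well-ordered subset of } G\}$. Then the $k$-hull $k((\mathcal{F}))$ is a subring (possibly without identity) of $\mathbb{K}$ if and only if $\mathcal{F}$ satisfies all of the following conditions: (S2) $A\in\mathcal{F}$ and $B\subseteq A$ implies $B\in\mathcal{F}$; (S3) $A,B\in\mathcal{F}$ implies $A\cup B\in\mathcal{F}$; (S5) $\mathcal{F}\neq\emptyset$; (A2) $A,B\in\mathcal{F}$ implies $A\oplus B\in\mathcal{F}$.
   Context: Ordered abelian groups are totally ordered. $\mathbb{K}=k((G))$ denotes the field of generalised power series with coefficient field $k$ and value group $G$: the set of all functions $s\colon G\to k$ whose support $\mathrm{supp}(s)=\{g\in G\mid s(g)\neq 0\}$ is a well-ordered subset of $G$, with pointwise addition and product $(rs)(g)=\sum_{h\in G}r(h)s(g-h)$. The $k$-hull of $\mathcal{F}$ in $\mathbb{K}$ is the set $k((\mathcal{F}))=\{a\in\mathbb{K}\mid \mathrm{supp}(a)\in\mathcal{F}\}$. For $A,B\subseteq G$, $A\oplus B=\{a+b\mid a\in A, b\in B\}$ (set of sums). $|\cdot|$ denotes cardinality. *)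

(* Defs.v *)
From HB Require Import structures.
From mathcomp Require Import all_boot all_order all_algebra finmap.
From mathcomp Require Import boolp classical_sets functions cardinality fsbigop.
From mathcomp Require Import wochoice.

Set Implicit Arguments.
Unset Strict Implicit.
Unset Printing Implicit Defensive.

Import Order.TTheory GRing.Theory Num.Theory.
Local Open Scope classical_set_scope.
Local Open Scope ring_scope.

(* MathComp's numeric hierarchy leaves no room for a join of Order.Total with
   Num.POrderedZmodule, so totality is a field of the mixin. *)
HB.mixin Record POrderedZmodule_isOrdered G of Num.POrderedZmodule G := {
  le_total_subproof : total (fun x y : G => x <= y);
  lerD2l_subproof : forall z x y : G, x <= y -> z + x <= z + y
}.

#[short(type="orderedZmodType")]
HB.structure Definition OrderedZmodule :=
  { G of Num.POrderedZmodule G & POrderedZmodule_isOrdered G }.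

Definition well_ordered (G : orderedZmodType) (A : set G) : Prop :=
  wo_chain (fun x y : G => x <= y) (mem A).

Definition setsum (G : zmodType) (A B : set G) : set G :=
  [set a + b | a in A & b in B].

Definition supp (G : Type) (k : nmodType) (s : G -> k) : set G :=
  [set g | s g != 0].

(* subring possibly without identity *)
Definition subrng_closed (R : pzRingType) (S : set R) : Prop :=
  zmod_closed [in S] /\ GRing.mulr_2closed [in S].

Section WellOrdered.
Variable G : orderedZmodType.
Implicit Types (A B X : set G) (x y z g h : G).

Lemma ord_comparable x y : (x >=< y)%O.
Proof. exact: le_total_subproof. Qed.

Lemma ord_leNgt x y : (x <= y) = ~~ (y < x).
Proof. exact: comparable_leNgt (ord_comparable x y). Qed.

Lemma ord_ltNge x y : (x < y) = ~~ (y <= x).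
Proof. exact: comparable_ltNge (ord_comparable x y). Qed.

Lemma well_orderedP A : well_ordered A <->
  forall X, X `<=` A -> X !=set0 -> exists2 m, X m & forall x, X x -> m <= x.
Proof.
split=> [woA X XA [x Xx]|woA].
  have sXA : {subset [in X] <= [in A]} by move=> y; rewrite !inE; exact: XA.
  have [|m [[Xm mX] _]] := woA _ sXA; first by exists x; rewrite inE.
  by exists m => [|y Xy]; [rewrite inE in Xm|apply: mX; rewrite inE].
move=> P PA [x Px].
have [||m Pm mP] := woA [set` P].
- by move=> y /PA; rewrite inE.
- by exists x.
exists m; split=> [//|y [Py yP]].
by apply/eqP; rewrite eq_le yP ?mP.
Qed.

Lemma sub_well_ordered A B : B `<=` A -> well_ordered A -> well_ordered B.
Proof.
move=> BA /well_orderedP woA; apply/well_orderedP => X XB.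
by apply: woA; apply: subset_trans BA.
Qed.

Lemma well_ordered1 x : well_ordered [set x].
Proof.
apply/well_orderedP => X X1 [y Xy]; exists y => // z /X1 ->.
by rewrite (X1 _ Xy).
Qed.

Lemma well_orderedU A B :
  well_ordered A -> well_ordered B -> well_ordered (A `|` B).
Proof.
move=> /well_orderedP woA /well_orderedP woB; apply/well_orderedP => X XAB X0.
have [[a XAa]|XA0] := pselect ((X `&` A) !=set0); last first.
  apply: woB => // x Xx; have [Ax|//] := XAB _ Xx.
  by exfalso; apply: XA0; exists x.
have [[b XBb]|XB0] := pselect ((X `&` B) !=set0); last first.
  apply: woA => // x Xx; have [//|Bx] := XAB _ Xx.
  by exfalso; apply: XB0; exists x.
have [||m [Xm Am] mA] := woA (X `&` A); [by move=> ? []|by exists a|].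
have [||n [Xn Bn] nB] := woB (X `&` B); [by move=> ? []|by exists b|].
have [mn|nm] := comparable_leP (ord_comparable m n).
- exists m => // x Xx; have [Ax|Bx] := XAB _ Xx; first exact: mA.
  by rewrite (le_trans mn)// nB.
- exists n => // x Xx; have [Ax|Bx] := XAB _ Xx; last exact: nB.
  by rewrite (le_trans (ltW nm))// mA.
Qed.

Lemma ordD2l z x y : (z + x <= z + y) = (x <= y).
Proof.
apply/idP/idP; last exact: lerD2l_subproof.
by move=> /(@lerD2l_subproof G (- z)); rewrite !addKr.
Qed.

Lemma ordD2r z x y : (x + z <= y + z) = (x <= y).
Proof. by rewrite -!(addrC z) ordD2l. Qed.

Lemma ordN2 x y : (- x <= - y) = (y <= x).
Proof.
by rewrite -(ordD2l (x + y) (- x)) addrK addrAC subrr add0r.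
Qed.

Lemma ordD x y x' y' : x <= x' -> y <= y' -> x + y <= x' + y'.
Proof. by move=> xx' yy'; rewrite (@le_trans _ _ (x' + y)) ?ordD2r ?ordD2l. Qed.

Lemma well_ordered_setsum A B :
  well_ordered A -> well_ordered B -> well_ordered (setsum A B).
Proof.
move=> /well_orderedP woA /well_orderedP woB; apply/well_orderedP => X XAB [x0 Xx0].
apply: contrapT => noX.
have drop x : X x -> exists2 y, X y & y < x.
  move=> Xx; apply: contrapT => noy; apply: noX; exists x => // y Xy.
  by rewrite ord_leNgt; apply/negP => yx; apply: noy; exists y.
pose P a b := [/\ A a, B b & X (a + b)].
have PX x : X x -> exists a b, P a b /\ a + b = x.
  by move=> Xx; have [a Aa [b Bb abx]] := XAB _ Xx; exists a, b; split=> //; split=> //; rewrite abx.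
pose Q a b := P a b /\ forall a' b', P a' b' -> a' + b' < a + b -> a <= a'.
have next (x : G) : X x -> exists a b, Q a b /\ a + b < x.
  move=> Xx; have [||a [Aa [b [Pab abx]]] amin] :=
    woA [set a | A a /\ exists b, P a b /\ a + b < x].
  - by move=> a [].
  - have [y Xy yx] := drop _ Xx; have [a [b [Pab aby]]] := PX _ Xy.
    by exists a; split; [case: Pab|exists b; rewrite aby].
  exists a, b; split=> //; split=> // a' b' Pab' ab'; apply: amin.
  by split; [case: Pab'|exists b'; split=> //; apply: lt_trans abx].
have [||b [Bb [a [Pab Qab]]] bmin] := woB [set b | B b /\ exists a, Q a b].
- by move=> b [].
- have [a [b [Qab _]]] := next _ Xx0.
  by exists b; split; [case: Qab => -[]|exists a].
have [a' [b' [Qab' ab']]] : exists a' b', Q a' b' /\ a' + b' < a + b.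
  by apply: next; case: Pab.
have aa' := Qab _ _ Qab'.1 ab'.
have bb' : b <= b' by apply: bmin; split; [case: Qab' => -[]|exists a'].
by move: ab'; rewrite ord_ltNge ordD.
Qed.

Lemma well_ordered_finite A B g : well_ordered A -> well_ordered B ->
  finite_set [set h | A h /\ B (g - h)].
Proof.
move=> /well_orderedP woA /well_orderedP woB.
set S := [set h | _].
have minS X : X `<=` S -> X !=set0 -> exists2 m, X m & forall x, X x -> m <= x.
  by move=> XS; apply: woA => x /XS[].
have maxS X : X `<=` S -> X !=set0 -> exists2 m, X m & forall x, X x -> x <= m.
  move=> XS [x Xx]; have [||_ [m Xm <-] mX] := woB [set g - h | h in X].
  - by move=> _ [h /XS[_ Bh] <-].
  - by exists (g - x), x.
  by exists m => // y Xy; have := mX (g - y); rewrite ordD2l ordN2; apply; exists y.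
apply: contrapT => infS.
pose L x := [set y | S y /\ y <= x].
have [||m [Sm infm] mmin] := minS [set x | S x /\ infinite_set (L x)].
- by move=> x [].
- have [||M SM Mmax] := maxS S; first by [].
    by apply/set0P; apply/negP => /eqP S0; apply: infS; rewrite S0.
  exists M; split=> // /(@sub_finite_set _ S) finS; apply: infS; apply: finS.
  by move=> y Sy; split=> //; exact: Mmax.
pose L' := [set y | S y /\ y < m].
have infL' : infinite_set L'.
  move=> finL'; apply: infm; apply: (@sub_finite_set _ _ (L' `|` [set m])).
    move=> y [Sy]; rewrite le_eqVlt => /orP[/eqP->|ym]; [by right|by left].
  by rewrite finite_setU; split=> //; exact: finite_set1.
have [||n [Sn nm] nmax] := maxS L'; first by move=> y [].
  by apply/set0P; apply/negP => /eqP S0; apply: infL'; rewrite S0.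
have : m <= n.
  apply: mmin; split=> // /(@sub_finite_set _ L') finL'; apply: infL'.
  by apply: finL' => y L'y; split; [case: L'y|exact: nmax].
by rewrite ord_leNgt nm.
Qed.

End WellOrdered.

Definition has_wosupp (k : fieldType) (G : orderedZmodType) : {pred G -> k} :=
  fun f => `[< well_ordered (supp f) >].

(* k((G)); its ring structure is the comNzRingType instance below *)
Record hahn (k : fieldType) (G : orderedZmodType) : Type := Hahn {
  hcoef :> G -> k;
  _ : has_wosupp hcoef
}.

Section Hahn.
Variables (k : fieldType) (G : orderedZmodType).
Local Notation K := (hahn k G).
Implicit Types (r s t : K) (f : G -> k) (g h : G).

HB.instance Definition _ := [isSub for @hcoef k G].
HB.instance Definition _ := [Choice of K by <:].

Lemma hahn_well_ordered s : well_ordered (supp s).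
Proof. by apply/asboolP; exact: (valP s). Qed.

Lemma hahn_ext r s : (forall g, r g = s g) -> r = s.
Proof. by move=> rs; apply/val_inj/funext. Qed.

Fact hahn_zmod_closed : zmod_closed (@has_wosupp k G).
Proof.
split=> [|f1 f2 /asboolP wo1 /asboolP wo2]; apply/asboolP.
  by apply/well_orderedP => X X0 [x /X0]; rewrite /supp /= eqxx.
apply: sub_well_ordered _ (well_orderedU wo1 wo2) => g; rewrite /supp /=.
have [f1g0|] := eqVneq (f1 g) 0; last by left.
have [f2g0|] := eqVneq (f2 g) 0; last by right.
by rewrite !fctE f1g0 f2g0 subrr eqxx.
Qed.

HB.instance Definition _ :=
  GRing.isZmodClosed.Build _ (@has_wosupp k G) hahn_zmod_closed.
HB.instance Definition _ := [SubChoice_isSubZmodule of K by <:].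

Lemma hahnD r s g : (r + s) g = r g + s g.
Proof. by []. Qed.

Lemma hahnN r g : (- r) g = - r g.
Proof. by []. Qed.

Lemma hahn0 g : (0 : K) g = 0.
Proof. by []. Qed.

Fact hone_subproof : has_wosupp (fun g : G => (g == 0)%:R : k).
Proof.
apply/asboolP; apply: sub_well_ordered _ (@well_ordered1 G 0) => g.
by rewrite /supp /=; have [->|_] := eqVneq g 0; rewrite ?eqxx.
Qed.
Definition hone : K := Hahn hone_subproof.

(* \sum_(_ \in _) is the sum of the nonzero terms when there are finitely many
   of them, which is the case here by [hmul_finite] *)
Definition hmul_coef r s g : k := \sum_(h \in [set: G]) r h * s (g - h).

Lemma hmul_finite r s g : finite_set [set h | r h != 0 /\ s (g - h) != 0].
Proof.
exact: (@well_ordered_finite G (supp r) (supp s) g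
  (@hahn_well_ordered r) (@hahn_well_ordered s)).
Qed.

Lemma hmul_coefE r s g (X : {fset G}) :
  (forall h, r h != 0 -> s (g - h) != 0 -> h \in X) ->
  hmul_coef r s g = \sum_(h <- X) r h * s (g - h).
Proof.
move=> rsX; apply: fsbigTE => h; apply: contraNeq.
by rewrite mulf_eq0 => /norP[rh sh]; apply: rsX.
Qed.

Lemma hmul_coef_neq0 r s g : hmul_coef r s g != 0 ->
  exists2 h, r h != 0 & s (g - h) != 0.
Proof.
move=> /(@fsbigN1 _ _ _ _ _ setT (fun g h => r h * s (g - h)) g)[h _].
by rewrite mulf_eq0 => /norP[rh sh]; exists h.
Qed.

Lemma supp_hmul r s : supp (hmul_coef r s) `<=` setsum (supp r) (supp s).
Proof.
move=> g; rewrite /supp /= => /hmul_coef_neq0[h rh sh].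
by exists h => //; exists (g - h) => //; rewrite addrC subrK.
Qed.

Fact hmul_subproof r s : has_wosupp (hmul_coef r s).
Proof.
by apply/asboolP/(sub_well_ordered (@supp_hmul r s))/well_ordered_setsum;
  exact: hahn_well_ordered.
Qed.
Definition hmul r s : K := Hahn (hmul_subproof r s).

Fact hmulC : commutative hmul.
Proof.
move=> r s; apply: hahn_ext => g /=; rewrite /hmul_coef.
rewrite (@reindex_fsbigT _ _ _ _ _ (fun h : G => g - h)) /=; last first.
  by exists (fun h => g - h) => h; rewrite subKr.
by apply: eq_fsbigr => h _; rewrite subKr mulrC.
Qed.

Fact hmul1 : left_id hone hmul.
Proof.
move=> s; apply: hahn_ext => g /=; rewrite (@hmul_coefE _ _ _ [fset 0]%fset).
  by rewrite big_seq_fset1 /= eqxx mul1r subr0.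
by move=> h /=; rewrite inE; have [->|_] := eqVneq h 0; rewrite ?eqxx.
Qed.

Fact hmulDl : left_distributive hmul +%R.
Proof.
move=> r s t; apply: hahn_ext => g; rewrite hahnD /=.
pose X := (fset_set [set h | r h != 0%R /\ t (g - h) != 0%R] `|`
           fset_set [set h | s h != 0%R /\ t (g - h) != 0%R])%fset.
rewrite !(@hmul_coefE _ _ _ X).
- by rewrite -big_split; apply: eq_bigr => h _; exact: mulrDl.
- move=> h sh th; rewrite in_fsetU !in_fset_set; try exact: hmul_finite.
  by apply/orP; right; rewrite inE.
- move=> h rh th; rewrite in_fsetU !in_fset_set; try exact: hmul_finite.
  by apply/orP; left; rewrite inE.
- move=> h; rewrite hahnD => rsh th.
  rewrite in_fsetU !in_fset_set; try exact: hmul_finite.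
  apply/orP; have [rh|rh] := eqVneq (r h) 0; last by left; rewrite inE.
  by right; rewrite inE; split=> //; move: rsh; rewrite rh add0r.
Qed.

Fact hmulA : associative hmul.
Proof.
move=> r s t; apply: hahn_ext => g /=.
set rs := hmul r s; set st := hmul s t.
have finH : finite_set
    [set h | setsum (supp r) (supp s) h /\ supp t (g - h)].
  apply: (@well_ordered_finite G); last exact: hahn_well_ordered.
  by apply: well_ordered_setsum; exact: hahn_well_ordered.
pose H := fset_set [set h | setsum (supp r) (supp s) h /\ supp t (g - h)].
have HP h i : r i != 0 -> s (h - i) != 0 -> t (g - h) != 0 -> h \in H.
  move=> ri shi tgh; rewrite in_fset_set// inE; split=> //.
  by exists i => //; exists (h - i) => //; rewrite addrC subrK.
pose D h := [set i | r i != 0 /\ s (h - i) != 0].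
have finI : finite_set (\bigcup_(h in [set` H]) D h).
  apply: bigcup_finite => [|h _]; first exact: finite_fset.
  exact: hmul_finite.
pose I := fset_set (\bigcup_(h in [set` H]) D h).
have IP h i : h \in H -> r i != 0 -> s (h - i) != 0 -> i \in I.
  by move=> Hh ri shi; rewrite in_fset_set// inE; exists h.
rewrite (@hmul_coefE rs t g H); last first.
  move=> h /supp_hmul rsh th.
  by rewrite in_fset_set// inE.
transitivity (\sum_(h <- H) \sum_(i <- I) r i * s (h - i) * t (g - h)); last first.
  rewrite big_seq [RHS]big_seq; apply: eq_bigr => h Hh.
  rewrite -mulr_suml; congr (_ * _); apply/esym/hmul_coefE => i.
  exact: IP.
rewrite exchange_big /= (@hmul_coefE r st g I); last first.
  move=> i ri; rewrite /= => /hmul_coef_neq0[j sj tj].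
  have shi : s (i + j - i) != 0 by rewrite addrAC subrr add0r.
  apply: (IP (i + j)) => //; apply: (HP _ i) => //.
  by rewrite opprD addrA.
apply: eq_bigr => i _.
have [->|ri] := eqVneq (r i) 0.
  by rewrite mul0r big1// => h _; rewrite !mul0r.
rewrite [st _](@hmul_coefE s t (g - i) [fset h - i | h in H]%fset).
  rewrite big_imfset /=; last by move=> x y _ _ /addIr.
  rewrite mulr_sumr; apply: eq_bigr => h _.
  by rewrite mulrA opprB addrA subrK.
move=> j sj tj; apply/imfsetP; exists (j + i) => /=; last by rewrite addrK.
by apply: (HP _ i) => //; rewrite ?addrK// opprD addrA addrAC.
Qed.

Fact hone_neq0 : hone != 0.
Proof.
by apply/eqP => /(congr1 (fun s : K => s 0))/eqP; rewrite /= eqxx oner_eq0.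
Qed.

HB.instance Definition _ :=
  GRing.Zmodule_isComNzRing.Build K hmulA hmulC hmul1 hmulDl hone_neq0.

Lemma hahn1 g : (1 : K) g = (g == 0)%:R.
Proof. by []. Qed.

Lemma hahnM r s g : (r * s) g = \sum_(h \in [set: G]) r h * s (g - h).
Proof. by []. Qed.

Definition khull (F : set (set G)) : set K := [set a : K | F (supp a)].

End Hahn.

Arguments khull k {G} F.

(* Main.v *)
From HB Require Import structures.
Require Import Defs.
From mathcomp Require Import all_boot all_order all_algebra finmap.
From mathcomp Require Import boolp classical_sets functions cardinality fsbigop.
From mathcomp Require Import wochoice.

(** If F has the four closure properties, then supp (a - b) lies in the union
    of the supports of a and b, and supp (a * b) in their sum, so the hull is a
    subring (lemma [subrng_khull]).

    For the converse, suppose first that k is infinite and pick c in k other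
    than 0 and 1. Writing f|A for the series with coefficients f on A and 0
    elsewhere, (S2) and (S3) come from differences of series with prescribed
    support: 1|A - f|A, where f is c on B and 1 off B, has support B
    whenever B is contained in A, and 1|A - c|B has support the union of A and
    B (lemmas [subrng_sub] and [subrng_setU]).

    For (A2), let C be the union of A and B. By (S2) it suffices that the sumset
    C + C is contained in the support of a product of two elements of the hull
    supported in C. Take 1|C * b|C: its coefficient at g is the sum of b over
    the finite set S_g of those h in C for which g - h is in C, so weights b
    are needed for which none of the sums over the nonempty S_g vanishes.
    In characteristic 0 the constant 1 will do, since the sum is then the number
    of elements of S_g (lemma [pchar0_weights]). If instead |C| <= |k|, the
    weights are chosen one at a time, along a well-order of C in which the
    elements up to any x number fewer than |k| (lemma [generic_weights]). When
    b x is chosen, the sums it has to keep away from 0 are those over the sets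
    S_g whose last element is x. Such a g is x + y with y also in S_g, hence y
    not after x; so each y up to x forbids at most one value of b x, and an
    admissible value remains. The count relies on x and its partner g - x
    lying in one and the same ordered set, hence the passage from A and B to C.
    Since b may vanish somewhere on C, (S2) is used to put b|C in the hull.

    Finally, if k is finite, then k has positive characteristic and every
    well-ordered subset of G is finite. The natural multiples of a positive
    element would form an infinite one, so G is trivial, and then every
    subset of G is empty or all of G. *)

Set Implicit Arguments.
Unset Strict Implicit.
Unset Printing Implicit Defensive.

Import Order.TTheory GRing.Theory.
Local Open Scope classical_set_scope.
Local Open Scope card_scope.
Local Open Scope ring_scope.

(** * Well-orders with small initial segments *)

Lemma card_le_injP (T : Type) (U : choiceType) (A : set T) (B : set U) :
  [set: U] !=set0 ->
  A #<= B <-> exists2 f : T -> U, set_fun A B f & set_inj A f.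
Proof.
move=> [u _]; pose pU : pointedType := HB.pack U (isPointed.Build U u).
split=> [/(@pcard_leP _ pU)[f]|/injfunPex[f]]; last exact: inj_card_le f.
by exists f => [x Ax|x y Ax Ay]; [exact: funS|exact: inj].
Qed.

(** An infinite set is Dedekind-infinite: shift a copy of the natural numbers by
    one step, which misses its first element, and fix everything else. *)
Lemma infinite_shift (T : choiceType) : infinite_set [set: T] ->
  exists (f : T -> T) (q : T), injective f /\ forall x, f x <> q.
Proof.
move=> infT; have T0 := infinite_setN0 infT.
have /infiniteP/(card_le_injP _ _ T0)[g _ gJ] := infT.
have gI m n : g m = g n -> m = n by apply: gJ; rewrite inE.
have /choice[f fP] : forall v, exists w, (forall n, v = g n -> w = g n.+1) /\
    ((forall n, v <> g n) -> w = v).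
  move=> v; have [[n ->]|nv] := pselect (exists n, v = g n).
    by exists (g n.+1); split=> [m /gI-> //|/(_ n)].
  by exists v; split=> // n vn; case: nv; exists n.
have fg n : f (g n) = g n.+1 by apply: (fP _).1.
have fid v : (forall n, v <> g n) -> f v = v by exact: (fP _).2.
exists f, (g 0); split=> [v w|v].
- have [[m ->]|nv] := pselect (exists n, v = g n);
    have [[n ->]|nw] := pselect (exists n, w = g n).
  + by rewrite !fg => /gI[->].
  + rewrite fg fid => [wE|n wn]; last by apply: nw; exists n.
    by case: nw; exists m.+1.
  + rewrite fg fid => [vE|m vm]; last by apply: nv; exists m.
    by case: nv; exists n.+1.
  + by rewrite !fid // => n E; [apply: nw|apply: nv]; exists n.
- have [[m ->]|nv] := pselect (exists n, v = g n); first by rewrite fg => /gI.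
  by rewrite fid => [vE|n vn]; apply: nv; [exists 0|exists n].
Qed.

Lemma well_order_min (T : Type) (R : rel T) (X : set T) : well_order R ->
  X !=set0 -> exists2 m, X m & forall x, X x -> R m x.
Proof.
move=> woR [x Xx]; have [|m [[Xm mX] _]] := woR [in X].
  by exists x; rewrite inE.
by exists m => [|y Xy]; [rewrite inE in Xm|apply: mX; rewrite inE].
Qed.

Lemma well_order_anti (T : eqType) (R : rel T) : well_order R -> antisymmetric R.
Proof.
move=> woR x y; have woc : wo_chain R predT by move=> A _; exact: woR.
exact: (wo_chain_antisymmetric woc).
Qed.

Lemma well_order_total (T : eqType) (R : rel T) : well_order R -> total R.
Proof.
move=> woR x y; have woc : wo_chain R predT by move=> A _; exact: woR.
exact: (wo_chainW woc).
Qed.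

(** This is the well-order of type the initial ordinal of |T|, obtained without
    ordinals: take any well-order R. If some closed initial segment has at
    least |T| elements, let x be the least element that ends one. An embedding of T into that segment can
    be made to avoid x because T is infinite, and R pulled back along it has
    only small closed initial segments, by minimality of x. *)
Lemma initial_well_order (T : choiceType) : infinite_set [set: T] ->
  exists2 R : rel T, well_order R & forall x, ~~ ([set: T] #<= [set y | R y x]).
Proof.
move=> infT; have T0 := infinite_setN0 infT.
have [R woR] := well_ordering_principle T.
have [[x0 x0big]|nbig] := pselect (exists x, [set: T] #<= [set y | R y x]);
  last by exists R => // x; apply/negP => xbig; apply: nbig; exists x.
have [x xbig xmin] := @well_order_min _ _ [set x | [set: T] #<= [set y | R y x]]
  woR (ex_intro _ x0 x0big).
have /(card_le_injP _ _ T0)[phi phiS phiJ] := xbig.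
have phiI v w : phi v = phi w -> v = w by apply: phiJ; rewrite inE.
have [f [q [fI fq]]] := infinite_shift infT.
(* q is not a value of f, so phi q is free to replace the value x *)
pose psi v := if phi (f v) == x then phi q else phi (f v).
have psiI : injective psi.
  move=> v w; rewrite /psi; case: eqP => [vx|_]; case: eqP => [wx|_] => /phiI.
  - by move=> _; apply/fI/phiI; rewrite vx.
  - by move=> qw; case: (fq w).
  - by move=> qv; case: (fq v).
  - exact: fI.
have phix v : R (phi v) x by exact: phiS.
have psix v : psi v != x /\ R (psi v) x.
  rewrite /psi; case: ifPn => // /eqP fvx; split=> //.
  by apply/eqP; rewrite -fvx => /phiI/esym/fq.
exists (relpre psi R).
  move=> A [a Aa].
  have [|_ [v Av <-] vmin] := @well_order_min _ _ (psi @` [set` A]) woR.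
    by exists (psi a); exists a.
  exists v; split=> [|w [Aw wmin]].
    by split=> // w Aw; apply: vmin; exists w.
  apply/psiI/(well_order_anti woR)/andP; split; last exact: wmin.
  by apply: vmin; exists w.
move=> z; apply/negP => zbig; have [zx Rzx] := psix z.
suff /xmin Rxz : [set: T] #<= [set y | R y (psi z)].
  by case/eqP: zx; apply/(well_order_anti woR); rewrite Rzx Rxz.
apply: card_le_trans zbig _.
apply/(card_le_injP _ _ T0); exists psi => [y|y w _ _]; [by []|exact: psiI].
Qed.

Lemma well_order_trans (T : eqType) (R : rel T) : well_order R -> transitive R.
Proof.
move=> woR y x z Rxy Ryz; have [|m mX mmin] :=
    @well_order_min _ _ [set t | [\/ t = x, t = y | t = z]] woR.
  by exists x; constructor.
have [Rmx Rmy Rmz] : [/\ R m x, R m y & R m z] by split; apply: mmin; constructor.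
case: mX => mE; subst m; first exact: Rmz.
- by rewrite [x](@well_order_anti _ _ woR x y) // Rxy.
- by rewrite -[z](@well_order_anti _ _ woR y z) // Ryz.
Qed.

Lemma finite_max (T : choiceType) (R : rel T) (X : set T) :
  total R -> transitive R -> finite_set X -> X !=set0 ->
  exists2 m, X m & forall x, X x -> R x m.
Proof.
move=> totR trR /finite_seqP[s ->{X}].
elim: s => [[x] //|x [|y s] IHs _].
  exists x => [|z]; rewrite /= inE // => /eqP ->.
  by have := totR x x; rewrite orbb.
have [|m ms mmax] := IHs; first by exists y; rewrite /= mem_head.
have [Rxm|Rmx] := orP (totR x m).
  by exists m => [|z]; rewrite /= inE ?ms ?orbT // => /predU1P[->|/mmax].
exists x => [|z]; rewrite /= inE ?eqxx // => /predU1P[->|/mmax Rzm].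
  by have := totR x x; rewrite orbb.
exact: trR Rzm Rmx.
Qed.

Lemma well_order_wf (T : Type) (U : eqType) (R : rel U) (phi : T -> U) :
  well_order R ->
  well_founded (fun x y => R (phi x) (phi y) && (phi x != phi y)).
Proof.
set lt := fun x y => _; move=> woR x; apply: contrapT => nx.
have [|_ [m nm <-] mmin] := @well_order_min _ _ (phi @` [set x | ~ Acc lt x]) woR.
  by exists (phi x), x.
apply: nm; constructor => y /andP[Rym ym]; apply: contrapT => ny.
case/eqP: ym; apply/(well_order_anti woR)/andP; split=> //.
by apply: mmin; exists y.
Qed.

(** Transfinite recursion in which the value at x is any one related by P to the
    values already chosen. To keep P a statement about total functions, the
    values not yet chosen are set to v0, and P is required to ignore them. *)
Lemma wf_choice (T : Type) (V : choiceType) (v0 : V) (lt : T -> T -> Prop)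
    (P : T -> (T -> V) -> V -> Prop) :
  well_founded lt ->
  (forall x f g v, (forall y, lt y x -> f y = g y) -> P x f v -> P x g v) ->
  (forall x f, exists v, P x f v) ->
  exists f, forall x, P x f (f x).
Proof.
move=> wf Ploc Pex.
pose ext x (f : forall y, lt y x -> V) y :=
  if pselect (lt y x) is left yx then f y yx else v0.
pose step x f := xget v0 (P x (ext x f)).
pose f := Fix wf (fun=> V) step.
have fE x : f x = step x (fun y _ => f y).
  apply: (@Fix_eq _ _ wf (fun=> V)) => {}x g h gh; congr step.
  by apply/functional_extensionality_dep => y; apply/functional_extensionality_dep.
exists f => x; apply: (Ploc _ (ext x (fun y _ => f y))).
  by move=> y yx; rewrite /ext; case: pselect.
rewrite fE /step; have [v Pv] := Pex x (ext x (fun y _ => f y)).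
by apply: xgetPex; exists v.
Qed.

(** * Weights with nonzero convolution sums *)

(** The index set of the convolution sum at g of two functions supported on C. *)
Definition summands (G : zmodType) (C : set G) (g : G) : set G :=
  [set h | C h /\ C (g - h)].

Lemma summands_setsum (G : zmodType) (C : set G) (g x y : G) :
  C x -> C y -> x + y = g -> summands C g x.
Proof. by move=> Cx Cy <-; rewrite /summands /= addrAC subrr add0r. Qed.

Lemma pchar0_weights (k : fieldType) (G : zmodType) (C : set G) :
  [pchar k] =i pred0 -> (forall g, finite_set (summands C g)) ->
  forall g, setsum C C g -> \sum_(h \in summands C g) (1 : k) != 0.
Proof.
move=> /pcharf0P char0 finC g [x Cx [y Cy xy]].
rewrite fsbig_finite // big_const_seq count_predT iter_addr_0 char0 cardfs_eq0.
apply/fset0Pn; exists x; rewrite in_fset_set //.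
by apply: mem_set; exact: (summands_setsum Cx Cy xy).
Qed.

(** The weights are chosen by recursion along the well-order R of k, transported
    to C by an embedding phi. The value b x must avoid, for each y in C up to x,
    only minus the sum of the earlier weights in the summands of x + y. If every
    value were forbidden, choosing a responsible y for each would embed k into
    an initial segment of R, which is too small. *)
Lemma generic_weights (k : fieldType) (G : zmodType) (C : set G) :
  infinite_set [set: k] -> C #<= [set: k] ->
  (forall g, finite_set (summands C g)) ->
  exists b : G -> k, forall g, setsum C C g ->
    \sum_(h \in summands C g) b h != 0.
Proof.
move=> infk /(card_le_injP _ _ (infinite_setN0 infk))[phi _ phiI] finC.
have [R woR Rsmall] := initial_well_order infk.
pose lt x y := R (phi x) (phi y) && (phi x != phi y).
pose rest (f : G -> k) x g :=
  \sum_(h \in summands C g `&` [set h | lt h x]) f h.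
have [b bP] : exists b : G -> k, forall x y, C y -> R (phi y) (phi x) ->
    b x + rest b x (x + y) != 0.
  pose P x (f : G -> k) v := forall y, C y -> R (phi y) (phi x) ->
    v + rest f x (x + y) != 0.
  apply: (@wf_choice G k 0 lt P) => [|x f g v fg Pf y Cy yx|x f].
  - exact: (well_order_wf phi woR).
  - suff <- : rest f x (x + y) = rest g x (x + y) by exact: Pf.
    by apply: eq_fsbigr => h; rewrite inE => -[_ /fg].
  - apply: contrapT => /forallNP noP; have /negP := Rsmall (phi x); apply.
    have /choice[e eP] : forall v, exists y,
        [/\ C y, R (phi y) (phi x) & v = - rest f x (x + y)].
      move=> v; have /existsNP[y] := noP v.
      move=> /not_implyP[Cy /not_implyP[yx /negP/negPn]].
      by rewrite addr_eq0 => /eqP; exists y.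
    apply/(card_le_injP _ _ (infinite_setN0 infk)).
    exists (phi \o e) => [v _|v w _ _ /=].
      by have [_ ] := eP v.
    have [Cv _ vE] := eP v; have [Cw _ wE] := eP w.
    by move=> /phiI evw; rewrite vE wE evw ?inE.
exists b => g [x0 Cx0 [y0 Cy0 xy0]].
have Sx0 := summands_setsum Cx0 Cy0 xy0.
(* x is the member of summands C g chosen last; its partner g - x was chosen
   no later, so x was chosen while taking care of the sum at g *)
have [_ [x [Cx Cgx] <-] xmax] : exists2 m, (phi @` summands C g) m &
    forall y, (phi @` summands C g) y -> R y m.
  apply: finite_max; [exact: well_order_total|exact: well_order_trans| |].
    by apply: finite_image; exact: finC.
  by exists (phi x0), x0.
have -> : \sum_(h \in summands C g) b h = b x + rest b x (x + (g - x)).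
  rewrite (fsbigD1 x) //=.
  congr (_ + _); rewrite addrC subrK; apply: eq_fsbigl.
  apply/seteqP; split=> h /= [Sh hx]; split=> //.
    apply/andP; split; first by apply: xmax; exists h.
    by apply: contra_not_neq hx => /phiI hx; apply: hx; rewrite inE //; case: Sh.
  by move=> hx'; case/andP: hx; rewrite hx' eqxx.
apply: bP => //; apply: xmax; exists (g - x) => //.
by split=> //; rewrite subKr.
Qed.

(** * Infinite coefficient fields *)

(** The natural multiples of a positive element form an infinite well-ordered
    set. *)
Lemma nonzero_mem_infinite (k : fieldType) (G : orderedZmodType) (x : G) :
  x != 0 -> (forall A : set G, well_ordered A -> A #<= [set: k]) ->
  infinite_set [set: k].
Proof.
wlog x0 : x / 0 < x.
  move=> IH xn0; have [|x0|x0] := comparable_ltgtP (ord_comparable 0 x).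
  - by move=> /IH; apply.
  - apply: (IH (- x)); last by rewrite oppr_eq0.
    by rewrite ord_ltNge -{1}(subrr x) -{1}(add0r (- x)) ordD2r -ord_ltNge.
  - by rewrite -x0 eqxx in xn0.
move=> _ large finK.
have mono m n : (m < n)%N -> x *+ m < x *+ n.
  elim: n => // n IHn; rewrite ltnS leq_eqVlt => mn.
  have ltS : x *+ n < x *+ n.+1.
    by rewrite mulrS ord_ltNge -{2}(add0r (x *+ n)) ordD2r -ord_ltNge.
  by case/predU1P: mn => [->//|/IHn/lt_trans]; apply.
have woA : well_ordered (range (fun n => x *+ n)).
  apply/well_orderedP => X XA [_ /[dup]/XA[n _ <-] Xn].
  have ex : exists n, `[< X (x *+ n) >] by exists n; apply/asboolP.
  exists (x *+ ex_minn ex); case: ex_minnP => m /asboolP Xm mmin //.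
  move=> _ /[dup]/XA[p _ <-] /asboolP /mmin; rewrite leq_eqVlt.
  by case/predU1P => [->//|/mono/ltW].
have finA : finite_set (range (fun n => x *+ n)).
  by apply: card_le_finite finK; exact: large.
apply: infinite_nat.
apply: sub_finite_set (finite_preimage _ finA) => [n _|m n _ _ /= mn].
  by exists n.
by have [/mono|/mono|//] := ltngtP m n; rewrite mn ltxx.
Qed.

Lemma pchar0_infinite (k : fieldType) :
  [pchar k] =i pred0 -> infinite_set [set: k].
Proof.
move=> /pcharf0P char0 fink; pose f n : k := n%:R.
apply: infinite_nat.
apply: sub_finite_set (finite_preimage (f := f) _ fink) => // m n _ _.
wlog mn : m n / (m <= n)%N.
  by move=> IH; case/orP: (leq_total m n) => /IH // + /esym mn => /(_ mn)/esym.
move=> /esym/eqP; rewrite -subr_eq0 -natrB // char0 subn_eq0 => nm.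
by apply/eqP; rewrite eqn_leq mn.
Qed.

(** * Series with prescribed support *)

Lemma suppE (G : Type) (k : nmodType) (s : G -> k) g : supp s g = (s g != 0).
Proof. by []. Qed.

Section Restriction.
Variables (k : fieldType) (G : orderedZmodType).
Implicit Types (A B : set G) (f : G -> k).

Definition restr_fun A f : G -> k := fun g => if `[< A g >] then f g else 0.

Lemma supp_restr_fun A f : supp (restr_fun A f) = A `&` supp f.
Proof.
apply/seteqP; rewrite /restr_fun; split=> g /=; rewrite /supp /=.
  by case: asboolP => // _; rewrite eqxx.
by case=> Ag fg; rewrite asboolT.
Qed.

Lemma restr_subproof A f : well_ordered A -> has_wosupp (restr_fun A f).
Proof.
move=> woA; apply/asboolP; apply: sub_well_ordered woA.
by rewrite supp_restr_fun => g [].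
Qed.

Definition restr A f (woA : well_ordered A) : hahn k G :=
  Hahn (restr_subproof f woA).

Lemma restrE A f (woA : well_ordered A) g : A g -> restr f woA g = f g.
Proof. by move=> Ag; rewrite /= /restr_fun asboolT. Qed.

Lemma restr_out A f (woA : well_ordered A) g : ~ A g -> restr f woA g = 0.
Proof. by move=> Ag; rewrite /= /restr_fun asboolF. Qed.

Lemma supp_restr A f (woA : well_ordered A) :
  (forall g, A g -> f g != 0) -> supp (restr f woA) = A.
Proof. by move=> f0; rewrite supp_restr_fun setIidl. Qed.

Lemma mul1_restr C b (woC : well_ordered C) g :
  (restr (fun=> 1) woC * restr b woC) g
  = \sum_(h \in summands C g) b h.
Proof.
rewrite mulrC hahnM [RHS]fsbig_mkcond; apply: eq_fsbigr => h _.
rewrite /patch; case: ifPn => [|/negP]; rewrite inE /=.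
  by move=> [Ch Cgh]; rewrite /restr_fun !asboolT // mulr1.
move=> nC; rewrite /restr_fun; case: asboolP => Ch; last by rewrite mul0r.
by case: asboolP => Cgh; rewrite ?mulr0 //; case: nC.
Qed.

End Restriction.

(** * Closure properties of a family whose hull is a subring *)

Section Forward.
Variables (k : fieldType) (G : orderedZmodType) (F : set (set G)).
Hypothesis F_wo : forall A, F A -> well_ordered A.
Hypothesis Frng : subrng_closed (khull k F).

Lemma subrng0 : F set0.
Proof.
have [[/(@set_mem _ _ _) F0 _] _] := Frng.
suff <- : supp (0 : hahn k G) = set0 by [].
by apply/seteqP; split=> g //; rewrite /supp /= eqxx.
Qed.

Lemma subrngB (r s : hahn k G) : F (supp r) -> F (supp s) -> F (supp (r - s)).
Proof.
by move=> Fr Fs; have [[_ FB] _] := Frng; apply/set_mem/FB; exact: mem_set.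
Qed.

Lemma subrngM (r s : hahn k G) : F (supp r) -> F (supp s) -> F (supp (r * s)).
Proof.
by move=> Fr Fs; have [_ FM] := Frng; apply/set_mem/FM; exact: mem_set.
Qed.

Variable c : k.
Hypotheses (c0 : c != 0) (c1 : c != 1).

Lemma subrng_sub A B : F A -> B `<=` A -> F B.
Proof.
move=> FA BA; pose f g := if `[< B g >] then c else 1.
have f0 g : A g -> f g != 0 by rewrite /f; case: ifP; rewrite ?oner_eq0.
suff <- : supp (restr (fun=> 1) (F_wo FA) - restr f (F_wo FA)) = B.
  by apply: subrngB; rewrite supp_restr // => g _; exact: oner_neq0.
apply/seteqP; split=> g; rewrite suppE hahnD hahnN.
  have [Ag|nAg] := pselect (A g); last by rewrite !restr_out // subrr eqxx.
  by rewrite !restrE // /f; case: asboolP => //; rewrite subrr eqxx.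
by move=> Bg; rewrite !restrE ?/f ?asboolT ?subr_eq0 1?eq_sym //; exact: BA.
Qed.

Lemma subrng_setU A B : F A -> F B -> F (A `|` B).
Proof.
move=> FA FB.
suff <- : supp (restr (fun=> 1) (F_wo FA) - restr (fun=> c) (F_wo FB))
    = A `|` B.
  by apply: subrngB; rewrite supp_restr // => g _; exact: oner_neq0.
apply/seteqP; split=> g; rewrite suppE hahnD hahnN.
  have [Ag|nAg] := pselect (A g); first by left.
  have [Bg|nBg] := pselect (B g); first by right.
  by rewrite !restr_out // subrr eqxx.
have [Ag|nAg] := pselect (A g); have [Bg|nBg] := pselect (B g) => AB.
- by rewrite !restrE // subr_eq0 eq_sym.
- by rewrite restrE // restr_out // subr0 oner_neq0.
- by rewrite restr_out // restrE // sub0r oppr_eq0.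
- by case: AB.
Qed.

(** Closure under union lets A and B be replaced by their union C, and closure
    under subsets makes it enough to reach a support containing the sumset. *)
Lemma subrng_setsum A B :
  (forall C, F C -> exists b : G -> k, forall g, setsum C C g ->
    \sum_(h \in summands C g) b h != 0) ->
  F A -> F B -> F (setsum A B).
Proof.
move=> weights FA FB; have FC := subrng_setU FA FB; set C := A `|` B in FC.
have [b bP] := weights _ FC; have woC := F_wo FC.
have Frs : F (supp (restr (fun=> 1) woC * restr b woC)).
  apply: subrngM; first by rewrite supp_restr // => g _; exact: oner_neq0.
  by apply: subrng_sub FC _; rewrite supp_restr_fun => g [].
apply: subrng_sub Frs _ => g [x Ax [y By xy]].
rewrite suppE mul1_restr; apply: bP.
by exists x; [left|exists y; [right|]].
Qed.

End Forward.

(** * The characterisation *)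

Lemma subrng_khull (k : fieldType) (G : orderedZmodType) (F : set (set G)) :
  (forall A B, F A -> B `<=` A -> F B) ->
  (forall A B, F A -> F B -> F (A `|` B)) ->
  F !=set0 ->
  (forall A B, F A -> F B -> F (setsum A B)) ->
  subrng_closed (khull k F).
Proof.
move=> Fsub FU [A0 FA0] Fsum; split; first split.
- by apply: mem_set; apply: Fsub FA0 _ => g; rewrite /supp /= eqxx.
- move=> r s /set_mem Fr /set_mem Fs; apply: mem_set.
  apply: Fsub (FU _ _ Fr Fs) _ => g.
  rewrite suppE hahnD hahnN.
  have [->|] := eqVneq (r g) 0; last by left.
  by rewrite sub0r oppr_eq0; right.
- move=> r s /set_mem Fr /set_mem Fs; apply: mem_set.
  apply: Fsub (Fsum _ _ Fr Fs) _.
  exact: supp_hmul.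
Qed.

Theorem proposition3p9 (k : fieldType) (G : orderedZmodType) (F : set (set G))
    (F_wo : forall A, F A -> well_ordered A)
    (k_large : [pchar k] =i pred0 \/
               (forall A : set G, well_ordered A -> A #<= [set: k])) :
  subrng_closed (khull k F) <->
  [/\ (forall A B, F A -> B `<=` A -> F B),
      (forall A B, F A -> F B -> F (A `|` B)),
      F !=set0
    & (forall A B, F A -> F B -> F (setsum A B))].
Proof.
split=> [Frng|[]]; last exact: subrng_khull.
have F0 := subrng0 Frng.
have [infk|fink] := pselect (infinite_set [set: k]).
  have [c [_]] : ([set: k] `\` [set 0; 1]) !=set0.
    by apply: infinite_setN0; apply: infinite_setD.
  move=> /not_orP[/eqP c0 /eqP c1].
  split; [exact: (subrng_sub F_wo Frng c0 c1)|
          exact: (subrng_setU F_wo Frng c0 c1)|by exists set0|].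
  move=> A B; apply: (subrng_setsum F_wo Frng c0 c1) => C FC.
  have finC g : finite_set (summands C g).
    by apply: well_ordered_finite; exact: F_wo.
  case: k_large => [char0|large]; last first.
    by apply: generic_weights => //; apply: large; exact: F_wo.
  by exists (fun=> 1); exact: pchar0_weights.
(* k is finite: G is trivial, and its subsets are the empty set and G *)
have G0 (x : G) : x = 0.
  apply/eqP; apply: contrapT => /negP x0; apply: fink.
  case: k_large => [|large]; first exact: pchar0_infinite.
  exact: nonzero_mem_infinite x0 large.
have dich (A : set G) x : A x -> A = setT.
  by move=> Ax; apply/seteqP; split=> // y _; rewrite (G0 y) -(G0 x).
have sub (A B : set G) : F A -> B `<=` A -> F B.
  move=> FA BA; have [->//|/set0P[x Bx]] := eqVneq B set0.
  by rewrite (dich B x) // -(dich A x) //; exact: BA.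
split=> // [A B FA FB| |A B FA FB]; last 1 first.
- have [->//|/set0P[_ [x Ax _]]] := eqVneq (setsum A B) set0.
  by apply: sub FA _; rewrite (dich A x).
- have [->|/set0P[x Ax]] := eqVneq A set0; first by rewrite set0U.
  by apply: sub FA _; rewrite (dich A x).
- by exists set0.
Qed.
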